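(* Let $H_{27}$ be the Heisenberg group of order $27$, i.e. the group of unitriangular $3\times 3$ matrices over the field with $3$ elements. Then $\mathsf{D}(H_{27})\le 8$.
   Context: For a finite group $G$, a sequence over $G$ is a finite multiset of elements of $G$ (an element of the free abelian monoid $\mathcal{F}(G)$ on the set $G$); its length is the number of its terms counted with multiplicity. A sequence is a product-one sequence if the product of its terms in some order equals $1_G$ (the empty sequence is product-one). Product-one sequences form a submonoid $\mathcal{B}(G)$ of $\mathcal{F}(G)$. An atom is a non-empty product-one sequence that is not the product (multiset union) of two non-empty product-one sequences. The large Davenport constant $\mathsf{D}(G)$ is the maximal length of an atom of $\mathcal{B}(G)$. *)

(* Defs.v *)
From mathcomp Require Import all_boot all_algebra all_fingroup.
From mathcomp Require Import finmap multiset.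
From mathcomp Require Import boolp.

Set Implicit Arguments.
Unset Strict Implicit.
Unset Printing Implicit Defensive.

Import GRing.Theory.

Local Open Scope group_scope.
Local Open Scope mset_scope.
Local Open Scope nat_scope.

Section Davenport.

Variable gT : finGroupType.
Implicit Types (G : {group gT}) (S T : {mset gT}).

(* A sequence over [G] is a multiset [S : {mset gT}] with [{subset S <= G}];
   its length is [size S]. *)

Definition product_one S : Prop :=
  exists2 s : seq gT, perm_eq s S & (\prod_(x <- s) x = 1)%g.

Definition atom G S : Prop :=
  [/\ {subset S <= G}, S <> mset0, product_one S
    & ~ exists S1 S2 : {mset gT},
        [/\ S1 <> mset0, S2 <> mset0, product_one S1, product_one S2
          & S = S1 `+` S2]].

Definition atom_length G (n : nat) : Prop :=
  exists2 S, atom G S & size S = n.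

Lemma size_mset_eq0 S : size S = 0 -> S = mset0.
Proof.
move=> S0; apply/msetP => x; rewrite mset0E -count_mem_mset.
by rewrite (size0nil S0).
Qed.

Lemma size_msetD S T : size (S `+` T) = size S + size T.
Proof.
rewrite -size_cat; apply: perm_size; apply/allP => x _ /=.
by rewrite count_cat !count_mem_mset msetE2.
Qed.

Lemma atom1 G : atom G [mset 1%g].
Proof.
have sz1 : size ([mset 1%g] : {mset gT}) = 1 by rewrite enum_msetn.
split.
- by move=> x; rewrite in_mset1 => /eqP->; apply: group1.
- by move=> e; move: sz1; rewrite e enum_mset0.
- by exists [:: 1%g]; rewrite ?enum_msetn ?big_seq1.
case=> S1 [S2 [n1 n2 _ _ e]]; move: sz1; rewrite e size_msetD.
case e1: (size S1) => [|a]; first by case: n1; apply: size_mset_eq0.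
case e2: (size S2) => [|b]; first by case: n2; apply: size_mset_eq0.
by rewrite addSn addnS.
Qed.

Lemma ex_atom_length G : exists n, `[< atom_length G n >].
Proof.
exists (size [mset 1%g : gT]); apply/asboolP.
by exists [mset 1%g]; first exact: atom1.
Qed.

Lemma atom_length_bound G n : `[< atom_length G n >] -> n <= #|G|.
Proof.
move=> /asboolP [S [sSG _ [s pS p1] irr] <-].
rewrite leqNgt; apply/negP => ltGS; apply: irr.
have szs : size s = size S by apply: perm_size.
have sG x : x \in s -> x \in G by rewrite (perm_mem pS); apply: sSG.
pose f (i : 'I_(size s)) := (\prod_(x <- take i s) x)%g.
have fG i : f i \in G.
  by rewrite /f big_seq; apply: group_prod => x /mem_take; apply: sG.
have /injectivePn [i0 [j0 nij0 eij0]] : ~~ injectiveb f.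
  apply/negP => /injectiveP injf; move: ltGS; rewrite -szs ltnNge => /negP; apply.
  rewrite -[size s]card_ord -(card_imset _ injf).
  by apply/subset_leq_card/subsetP => _ /imsetP[i _ ->].
wlog ltij : i0 j0 nij0 eij0 / i0 < j0.
  move=> W; case: (ltngtP i0 j0) => [lt|lt|/val_inj e].
  - exact: (W i0 j0).
  - by apply: (W j0 i0) => //; rewrite eq_sym.
  - by rewrite e eqxx in nij0.
pose a := take i0 s; pose b := drop i0 (take j0 s); pose c := drop j0 s.
have eab : take j0 s = a ++ b.
  by rewrite /a /b -[LHS](cat_take_drop i0) take_takel // ltnW.
have es : s = a ++ b ++ c by rewrite catA -eab cat_take_drop.
have b1 : (\prod_(x <- b) x = 1)%g.
  move: eij0; rewrite /f eab big_cat /= => e.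
  by apply: (mulgI (\prod_(x <- a) x)%g); rewrite mulg1 -e.
have szb : size b = j0 - i0.
  by rewrite size_drop size_takel // ltnW.
have szc : size c = size s - j0 by rewrite size_drop.
have nz t : 0 < size t -> seq_mset t <> mset0 :> {mset gT}.
  move=> t0 e; move: t0; rewrite -(perm_size (perm_eq_seq_mset t)) e.
  by rewrite enum_mset0.
exists (seq_mset b), (seq_mset (a ++ c)); split.
- by apply: nz; rewrite szb subn_gt0.
- by apply: nz; rewrite size_cat szc addn_gt0 subn_gt0 ltn_ord orbT.
- by exists b => //; rewrite perm_sym perm_eq_seq_mset.
- exists (a ++ c); first by rewrite perm_sym perm_eq_seq_mset.
  by move: p1; rewrite es !big_cat /= b1 mul1g.
apply/msetP => x; rewrite msetE2 !mset_seqE -count_mem_mset.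
by rewrite -(seq.permP pS) es !count_cat; rewrite addnCA.
Qed.

(* The maximum exists because an atom of length greater than [#|G|], taken in
   an order with product one, has two equal prefix products and so splits. *)
Definition large_davenport G : nat :=
  ex_maxn (ex_atom_length G) (@atom_length_bound G).

End Davenport.

Section Heisenberg.

Variable F : finFieldType.

(* [is_trig_mx] means lower triangular, hence the transpose. *)
Definition unitriangular (n : nat) (A : 'M[F]_n) : bool :=
  is_trig_mx A^T && [forall i, A i i == 1%R].

Definition heisenberg_set : {set {'GL_3[F]}} :=
  [set u | unitriangular (GLval u)].

Lemma heisenberg_group_set : group_set heisenberg_set.
Proof.
apply/group_setP; split=> [|u v].
  rewrite inE /unitriangular GL_1E; apply/andP; split.
    by rewrite trmx1 scalar_mx_is_trig.
  by apply/forallP => i; rewrite mxE eqxx.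
rewrite !inE /unitriangular GL_MxE.
case/andP=> /is_trig_mxP tu /forallP du /andP[/is_trig_mxP tv /forallP dv].
have tu' (i j : 'I_3) : j < i -> GLval u i j = 0%R by move/tu; rewrite mxE.
have tv' (i j : 'I_3) : j < i -> GLval v i j = 0%R by move/tv; rewrite mxE.
apply/andP; split.
  apply/is_trig_mxP => i j ij; rewrite !mxE big1 // => k _.
  have [/tu'->|jk] := ltnP k j; first by rewrite mul0r.
  by rewrite tv' ?mulr0 // (leq_trans ij).
apply/forallP => i; rewrite mxE (bigD1 i) //= (eqP (du i)) (eqP (dv i)) mulr1.
rewrite big1 ?addr0 // => k nki.
have [/tu'->|ik] := ltnP k i; first by rewrite mul0r.
by rewrite tv' ?mulr0 // ltn_neqAle ik andbT eq_sym.
Qed.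

Canonical heisenberg : {group {'GL_3[F]}} := Group heisenberg_group_set.

End Heisenberg.

Definition H27 : {group {'GL_3(3)}} := heisenberg 'F_3.

Lemma card_H27 : #|H27| = 27.
Proof.
pose m (t : 'F_3 * 'F_3 * 'F_3) : 'M['F_3]_3 :=
  (\matrix_(i, j) (if i == j then 1 else if (j < i)%N then 0
    else if i == 1%N :> nat then t.1.1 else if j == 1%N :> nat then t.1.2
    else t.2))%R.
have mU t : unitriangular (m t).
  apply/andP; split; last by apply/forallP => i; rewrite mxE eqxx.
  apply/is_trig_mxP => i j ij; rewrite !mxE ij.
  by rewrite -val_eqE /= gtn_eqF.
have mV t : m t \is a GRing.unit.
  have /andP[mt /forallP md] := mU t.
  change (m t \in unitmx); rewrite unitmxE -det_tr det_trig // big1 ?unitr1 // => i _.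
  by rewrite mxE (eqP (md i)).
pose g t : {'GL_3(3)} := FinRing.unit _ (mV t).
have ginj : injective g.
  move=> t t' /(congr1 val) /= /matrixP e.
  move: (e (inord 1) (inord 2)) (e (inord 0) (inord 1)) (e (inord 0) (inord 2)).
  rewrite !mxE -!val_eqE /= !inordK //=.
  by case: t t' {e} => [[a b] c] [[a' b'] c'] /= -> -> ->.
suff -> : H27 = [set g t | t in setT] :> {set _}.
  by rewrite card_imset // cardsT !card_prod !card_Fp.
apply/setP => u; apply/idP/imsetP => [|[t _ ->]]; last by rewrite inE; apply: mU.
rewrite inE => /andP[/is_trig_mxP ut /forallP ud].
exists (GLval u (inord 1) (inord 2), GLval u (inord 0) (inord 1),
        GLval u (inord 0) (inord 2)) => //.
apply/val_inj/matrixP => i j; rewrite /= mxE.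
have [<-|nij] := eqVneq i j; first exact/eqP.
have [ji|ij] := ltnP j i; first by have := ut j i ji; rewrite mxE.
case: i j nij ij {ut ud} => [[|[|[|]]] //= hi] [[|[|[|]]] //= hj] _ _;
  by congr (GLval u _ _); apply: val_inj; rewrite /= inordK.
Qed.

(* Main.v *)
Require Import Defs.
From mathcomp Require Import all_boot all_algebra all_fingroup.
From mathcomp Require Import finmap multiset boolp ring.

Set Implicit Arguments.
Unset Strict Implicit.
Unset Printing Implicit Defensive.

Import GRing.Theory.

Local Open Scope mset_scope.
Local Open Scope nat_scope.

(** If a product-one sequence is long, replacing two terms [x], [y] that are
    adjacent in an ordering of product one by the single term [x * y] shortens
    it, and a factorization of the shorter sequence lifts back
    ([splittable_expand]). Hence it suffices to split every product-one sequence
    of length exactly 9.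

    The quotient of [H27] by its centre, of order 3, is the plane over ['F_3];
    call the image of an element its label. Two elements commute if and only if
    the symplectic form [symp] vanishes on their labels. If the labels of a
    sequence sum to zero, then its product is central for every ordering, and
    exchanging two adjacent terms [x], [y] changes it by [symp x y] up to sign.
    When the sequence contains two disjoint non-commuting pairs, the two
    exchanges are independent, and a sum of two 2-element subsets of a group of
    order 3 is the whole group: some ordering has product one, whatever the
    central coordinates of the terms are ([flexible_prod1]). So a sequence
    splits if its labels split into two flexible parts.

    The multisets of nine labels without such a splitting are covered by three
    further arguments.
    - Five commuting terms lie in an elementary abelian group of order 9, whose
      Davenport constant is 5, so some of them multiply to one; the remaining
      terms of the sequence are again product-one if they are flexible, or if
      the five terms commute with all others ([long_line_splittable]).
    - A triangle, that is, three non-commuting terms with labels of sum zero, is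
      product-one unless its central coordinates sum to zero
      ([prod1_triangle]). In that case, adding a central term other than one
      makes it product-one ([triangle_zero_splittable]).
    - If the label of a vertex of a triangle occurs three times, then either the
      triangle is product-one for some choice of that vertex, or the three terms
      with this label are equal, and their product is a cube, hence one
      ([triangle_cube_splittable]).
    That one of the four arguments applies to each multiset of nine labels with
    sum zero is a finite verification ([all_reducible]). *)

(** * Product-one sequences *)

Section Sequences.

Variable gT : finGroupType.
Implicit Types (x y : gT) (s t a b : seq gT).
Local Open Scope group_scope.

Definition prod1 s : Prop := exists2 t, perm_eq t s & \prod_(x <- t) x = 1.

Definition splittable s : Prop :=
  exists a b, [/\ perm_eq s (a ++ b), a != [::], b != [::], prod1 a & prod1 b].

Lemma prod1_perm s t : perm_eq s t -> prod1 s -> prod1 t.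
Proof. by move=> st [u us u1]; exists u => //; apply: perm_trans us st. Qed.

Lemma splittable_perm s t : perm_eq s t -> splittable s -> splittable t.
Proof.
move=> st [a [b [sab a0 b0 a1 b1]]]; exists a, b; split=> //.
by rewrite -(permPl st).
Qed.

Lemma prod1_expand x y s : prod1 (x * y :: s) -> prod1 (x :: y :: s).
Proof.
case=> t ts t1; have : x * y \in t by rewrite (perm_mem ts) mem_head.
move=> xyt; case/splitPr: xyt ts t1 => t1 t2 ts t12.
exists (t1 ++ x :: y :: t2); last first.
  by move: t12; rewrite !big_cat /= !big_cons !mulgA.
rewrite perm_catC /= !perm_cons.
by move: ts; rewrite perm_catC /= perm_cons.
Qed.

Lemma splittable_expand x y s :
  splittable (x * y :: s) -> splittable (x :: y :: s).
Proof.
case=> a [b [sab a0 b0 a1 b1]].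
wlog xya : a b a0 b0 a1 b1 sab / x * y \in a.
  move=> W; have := mem_head (x * y) s.
  rewrite (perm_mem sab) mem_cat => /orP[|] xy; first exact: (W a b).
  by apply: (W b a) => //; rewrite perm_sym perm_catC perm_sym.
have ea := perm_to_rem xya.
exists (x :: y :: rem (x * y) a), b; split=> //.
  rewrite /= !perm_cons -(perm_cons (x * y)) (permPl sab).
  by rewrite -cat_cons perm_cat2r.
by apply: prod1_expand; apply: prod1_perm a1.
Qed.

(** Merging can be repeated down to any prescribed length, so that the absence
    of atoms of one length excludes all longer ones. *)
Lemma splittable_from n : 0 < n ->
  (forall s, size s = n -> prod1 s -> splittable s) ->
  forall s, n <= size s -> prod1 s -> splittable s.
Proof.
move=> n0 Hn s; have [k] := ubnP (size s - n).
elim: k s => // k IH s sk.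
rewrite leq_eqVlt => /orP[/eqP/esym/Hn//|ns] [t ts t1].
apply: (splittable_perm ts); rewrite -(perm_size ts) in ns sk.
case: t {ts} t1 ns sk => [|x [|y t]] t1 ns sk; first by [].
  by case: n n0 ns {IH sk Hn}.
apply: splittable_expand; apply: IH => /=.
- by move: sk => /=; rewrite subSn.
- by [].
by exists (x * y :: t) => //; move: t1; rewrite !big_cons mulgA.
Qed.

(** Unlike in an abelian group, the complement of a product-one part need not be
    product-one; it is when the part can be moved to the front of any
    ordering. *)
Lemma prod1_remove a b :
  {in a & a ++ b, forall x y, commute x y} ->
  (\prod_(x <- a) x = 1)%g -> prod1 (a ++ b) -> prod1 b.
Proof.
move=> ab a1 [t tab t1].
suff [u ub tE] : exists2 u, perm_eq u b &
    (\prod_(x <- t) x = (\prod_(x <- a) x) * \prod_(x <- u) x)%g.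
  by exists u => //; move: t1; rewrite tE a1 mul1g.
elim: a t ab tab {a1 t1} => [|x a IH] t ab tab.
  by exists t; rewrite // big_nil mul1g.
have xt : x \in t by rewrite (perm_mem tab) mem_head.
have xC : {in t, forall y, commute x y}.
  by move=> y; rewrite (perm_mem tab) => /(ab x y (mem_head _ _)).
case/splitPr: xt tab xC => t1 t2 tab xC.
have [|| u ub tE] := IH (t1 ++ t2).
- by move=> y z ya zb; apply: ab; rewrite ?in_cons ?ya ?zb orbT.
- by move: tab; rewrite -cat_rcons -cats1 -catA perm_catCA cat1s perm_cons.
exists u => //; rewrite big_cons -mulgA -tE !big_cat big_cons /= !mulgA.
congr (_ * _)%g; apply/esym; rewrite big_seq.
by apply: commute_prod => y yt; apply: xC; rewrite mem_cat yt.
Qed.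

Lemma splittable_one s :
  1%g \in s -> 1 < size s -> prod1 s -> splittable s.
Proof.
move=> s1 sz ps; have sE := perm_to_rem s1.
exists [:: 1%g], (rem 1%g s); split=> //.
- by move: sz; rewrite (perm_size sE); case: (rem _ _).
- by exists [:: 1%g]; rewrite ?big_seq1.
apply: (prod1_remove (a := [:: 1%g])); last by apply: prod1_perm ps.
  by move=> x y; rewrite inE => /eqP-> _; exact/commute_sym/commute1.
by rewrite big_seq1.
Qed.

End Sequences.

Lemma perm_map_lift (T T' : eqType) (f : T -> T') (s : seq T) (L : seq T') :
  perm_eq (map f s) L -> exists2 t, perm_eq t s & map f t = L.
Proof.
elim: L s => [|v L IH] s sL.
  by exists [::] => //; move/perm_nilP: sL; case: s.
have /mapP[x xs vE] : v \in map f s by rewrite (perm_mem sL) mem_head.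
have [|t tr tL] := IH (rem x s).
  rewrite -(perm_cons v) -(permPr sL) vE -map_cons.
  by rewrite perm_sym; apply/perm_map/perm_to_rem.
exists (x :: t); last by rewrite /= tL -vE.
by rewrite perm_sym (permPl (perm_to_rem xs)) perm_cons perm_sym.
Qed.

Lemma atom_not_splittable (gT : finGroupType) (G : {group gT})
    (S : {mset gT}) (s : seq (subg_of G)) :
  atom G S -> perm_eq (map sgval s) S -> ~ splittable s.
Proof.
case=> _ _ _ irr sS [a [b [sab a0 b0 a1 b1]]]; apply: irr.
have ne t : t != [::] -> seq_mset (map sgval t) <> mset0 :> {mset gT}.
  move=> t0 e; move: (perm_eq_seq_mset (map sgval t)); rewrite e enum_mset0.
  by move/perm_size; case: t t0 e.
have p1 (t : seq (subg_of G)) : prod1 t -> product_one (seq_mset (map sgval t)).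
  case=> u ut u1; exists (map sgval u).
    by rewrite (permPr (perm_eq_seq_mset _)) perm_map.
  by rewrite big_map -(morph_prod (sgval_morphism G)) ?u1 ?morph1.
exists (seq_mset (map sgval a)), (seq_mset (map sgval b)); split; auto.
apply/msetP => x; rewrite msetE2 !mset_seqE -count_mem_mset -(seq.permP sS).
by rewrite -count_cat -map_cat; apply/seq.permP/perm_map.
Qed.

Lemma large_davenport_le (gT : finGroupType) (G : {group gT}) n :
  (forall s : seq (subg_of G), size s = n.+1 -> prod1 s -> splittable s) ->
  large_davenport G <= n.
Proof.
move=> Hn; rewrite /large_davenport; case: ex_maxnP => m /asboolP[S atS <-] _.
rewrite leqNgt; apply/negP => nS.
have [sSG _ [s sS s1] _] := atS.
have sE : map sgval (map (subg G) s) = s.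
  rewrite -map_comp map_id_in // => x xs /=.
  by rewrite subgK // sSG // -(perm_mem sS).
apply: (atom_not_splittable (s := map (subg G) s) atS); first by rewrite sE.
apply: (splittable_from (n := n.+1)) => //.
  by rewrite size_map (perm_size sS).
exists (map (subg G) s) => //; apply: val_inj => /=.
change val with (@sgval _ G).
rewrite (morph_prod (sgval_morphism G)) //.
by rewrite -(big_map sgval xpredT id) sE s1.
Qed.

(** * Enumerating multisets and subsequences *)

(** Each multiset of [n] elements of [v] is listed once, as the sequence that
    follows the order of [v]: [x] may be repeated, or abandoned for good. *)
Fixpoint multisets (T : Type) n (v : seq T) : seq (seq T) :=
  if n is n'.+1 then
    (fix aux v :=
       if v is x :: v' then [seq x :: l | l <- multisets n' v] ++ aux v'
       else [::]) v
  else [:: [::]].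

Lemma multisetsS (T : Type) n x (v : seq T) :
  multisets n.+1 (x :: v) =
  [seq x :: l | l <- multisets n (x :: v)] ++ multisets n.+1 v.
Proof. by []. Qed.

Lemma multisetsP (T : eqType) (v s : seq T) :
  {subset s <= v} -> exists2 L, L \in multisets (size s) v & perm_eq s L.
Proof.
elim: v s => [|x v IHv] s sv.
  by case: s sv => [|y s] sv; [exists [::] | have := sv y (mem_head _ _)].
have [n] := ubnP (size s); elim: n s sv => // n IHs s sv sn.
have [xs|xs] := boolP (x \in s); last first.
  have [|L Lv sL] := IHv s.
    move=> y ys; have := sv y ys; rewrite inE => /orP[/eqP yx|//].
    by rewrite yx (negPf xs) in ys.
  exists L => //; case: (size s) Lv => [//|k] Lv.
  by rewrite multisetsS mem_cat Lv orbT.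
have sx := perm_to_rem xs.
have sz : size s = (size (rem x s)).+1 by rewrite (perm_size sx).
have [||L Lv sL] := IHs (rem x s).
- by move=> y /mem_rem; apply: sv.
- by move: sn; rewrite sz.
exists (x :: L); last by rewrite (permPl sx) perm_cons.
by rewrite sz multisetsS mem_cat map_f.
Qed.

Fixpoint masks n : seq bitseq :=
  if n is n'.+1 then [seq b :: m | b <- [:: true; false], m <- masks n']
  else [:: [::]].

Lemma masksP n (m : bitseq) : (m \in masks n) = (size m == n).
Proof.
elim: n m => [|n IH] [|b m] //; first by apply/allpairsP => -[[]] ? ? [].
rewrite eqSS -IH; apply/allpairsP/idP => [[[c l] [_ ml [_ ->]]] //|mn].
by exists (b, m); split=> //; case: b.
Qed.

Notation neg m := (map negb m).

Lemma perm_mask_neg (T : eqType) (m : bitseq) (s : seq T) : size m = size s ->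
  perm_eq s (mask m s ++ mask (neg m) s).
Proof.
elim: s m => [|x s IH] [|[] m] //= [/IH sm]; rewrite ?perm_cons //.
by rewrite -[x :: mask _ s]cat1s perm_sym perm_catCA /= perm_cons perm_sym.
Qed.

Lemma mask_neq0 (T : eqType) m (s : seq T) :
  size m = size s -> has id m -> mask m s != [::].
Proof. by move=> ms; rewrite has_count -size_eq0 size_mask // lt0n. Qed.

Lemma perm_swap (T : eqType) (a b : T) (s : seq T) :
  perm_eq [:: a, b & s] [:: b, a & s].
Proof. by apply/seq.permP=> p /=; rewrite addnCA. Qed.

(** * Labels in the plane over the field with three elements *)

Implicit Types (L : seq (nat * nat)) (u v w : nat * nat).

(** Coordinates are natural numbers below 3 rather than elements of ['F_3],
    whose operations evaluate too slowly for the enumerations below. *)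
Definition plane : seq (nat * nat) :=
  [seq (i, j) | i <- iota 0 3, j <- iota 0 3].

Definition zero_sum L := (3 %| sumn (unzip1 L)) && (3 %| sumn (unzip2 L)).

Lemma zero_sum_perm L L' : perm_eq L L' -> zero_sum L = zero_sum L'.
Proof.
move=> LL; rewrite /zero_sum !sumnE.
by rewrite (perm_big _ (perm_map fst LL)) (perm_big _ (perm_map snd LL)).
Qed.

Definition zero_sum_sub L :=
  has (fun m => has id m && zero_sum (mask m L)) (masks (size L)).

Lemma zero_sum_sub_perm L L' :
  perm_eq L L' -> zero_sum_sub L -> zero_sum_sub L'.
Proof.
move=> LL /hasP[m]; rewrite masksP => /eqP mL /andP[m1 mz].
have /count_subseqP[T /subseqP[m' m'L TE] mT] :
    forall x, count_mem x (mask m L) <= count_mem x L'.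
  by move=> x; rewrite -(seq.permP LL); apply/leq_count_subseq/mask_subseq.
apply/hasP; exists m'; first by rewrite masksP m'L.
rewrite -TE -(zero_sum_perm mT) mz andbT.
rewrite has_count -(size_mask m'L) -TE -(perm_size mT).
by rewrite size_mask // -has_count.
Qed.

(** Five is the Davenport constant of the elementary abelian group of order 9.
    There are only 1287 multisets to inspect. *)
Lemma davenport_plane L : size L = 5 -> {subset L <= plane} -> zero_sum_sub L.
Proof.
move=> L5 Lp; have [L' L'5 LL] := multisetsP Lp.
rewrite perm_sym in LL; apply: (zero_sum_sub_perm LL).
have /allP : all zero_sum_sub (multisets 5 plane) by vm_compute.
by apply; rewrite -L5.
Qed.

Definition aligned u v := u.1 * v.2 == u.2 * v.1 %[mod 3].

Definition twisted L := has (fun u => has (fun v => ~~ aligned u v) L) L.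

(** Enough freedom in the ordering to reach every central value, see
    [flexible_prod1]. *)
Definition flexible L :=
  zero_sum L &&
  has (fun u => has (fun v => ~~ aligned u v && twisted (rem v (rem u L)))
                    (rem u L)) L.

Definition split_flexible L :=
  has (fun m => flexible (mask m L) && flexible (mask (neg m) L))
      (masks (size L)).

(** The terms of the triangle are removed one after the other, so that [P] is
    tested on the labels that remain. *)
Definition has_triangle (P : _ -> _ -> _ -> _ -> bool) L :=
  has (fun u => has (fun v => ~~ aligned u v &&
      has (fun w => zero_sum [:: u; v; w] && P u v w (rem w (rem v (rem u L))))
          (rem v (rem u L)))
    (rem u L)) L.

(** The two flexible sequences are the complements of the triangle with and
    without the central term. *)
Definition triangle_zero := has_triangle (fun u v w L =>
  [&& (0, 0) \in L, flexible (rem (0, 0) L)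
    & flexible ((0, 0) :: rem (0, 0) L)]).

(** The two flexible sequences are the complements of a triangle and of the
    three terms with label [u]. *)
Definition triangle_cube := has_triangle (fun u v w L =>
  let R := rem u (rem u L) in
  [&& u \in L, u \in rem u L, flexible [:: u, u & R] & flexible [:: v, w & R]]).

(** Which of the five aligned terms [U] multiply to one depends on their central
    coordinates, so every nonempty zero-sum part of [U] must leave a flexible
    complement, unless [U] is central in the whole sequence. *)
Definition long_line L := has (fun m =>
    let U := mask m L in let C := mask (neg m) L in
    [&& size U == 5, ~~ twisted U
      & all (fun u => all (aligned u) C) U ||
        all (fun d => has id d && zero_sum (mask d U) ==>
                      flexible (mask (neg d) U ++ C)) (masks 5)])
  (masks (size L)).

Definition reducible L :=
  zero_sum L ==>
  [|| long_line L, triangle_zero L, triangle_cube L | split_flexible L].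

Lemma all_reducible : all reducible (multisets 9 plane).
Proof.
(* The virtual machine evaluates both arguments of a boolean connective; once
   these are unfolded to conditionals, each search stops at the first success. *)
cbv beta delta [reducible split_flexible triangle_zero triangle_cube long_line
  has_triangle flexible twisted zero_sum aligned has all andb orb implb negb].
vm_cast_no_check (erefl true).
Qed.

(** * Arithmetic of the field with three elements *)

Lemma F3_ind (P : 'F_3 -> Prop) : P 0%R -> P 1%R -> P (-1)%R -> forall x, P x.
Proof.
move=> P0 P1 P2 x.
have : (x == 0)%R || (x == 1)%R || (x == -1)%R.
  by move: x; case=> [[|[|[|]]] ?].
by case/orP => [/orP[]|] /eqP->.
Qed.

Lemma F3_3 (x : 'F_3) : (x *+ 3 = 0)%R.
Proof. by rewrite -mulr_natr (_ : 3%:R = 0)%R ?mulr0 //; apply/val_inj. Qed.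

(** A sum of two 2-element subsets of a group of order 3 is the whole group. *)
Lemma F3_choose (p a b : 'F_3) : (a != 0 -> b != 0 ->
  [|| p == 0, p - a == 0, p - b == 0 | p - b - a == 0])%R.
Proof. by move: p a b; do 3!elim/F3_ind. Qed.

Lemma F3_opp (p a : 'F_3) : (p != 0 -> a != 0 -> p = a \/ p = - a)%R.
Proof.
move: p a; do 2!elim/F3_ind => //; rewrite ?opprK;
  first [by left | by right].
Qed.

(** * Groups with Heisenberg coordinates *)

(** The central coordinate [ch] is the corner entry of the matrix corrected by a
    quadratic term. This makes it additive on commuting elements, and products
    in the two orders differ from the sum by opposite amounts. *)
Record heis_coords (gT : finGroupType) := HeisCoords {
  cx : gT -> 'F_3;
  cy : gT -> 'F_3;
  ch : gT -> 'F_3;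
  cxM : forall x y, cx (x * y)%g = (cx x + cx y)%R;
  cyM : forall x y, cy (x * y)%g = (cy x + cy y)%R;
  ch_mul : forall x y,
    ch (x * y)%g = (ch x + ch y - (cx x * cy y - cy x * cx y))%R;
  coord_inj : forall x y, cx x = cx y -> cy x = cy y -> ch x = ch y -> x = y
}.

Section HeisenbergCoordinates.

Variables (gT : finGroupType) (H : heis_coords gT).
Implicit Types (x y z : gT) (s t : seq gT).

Local Notation cx := (cx H).
Local Notation cy := (cy H).
Local Notation ch := (ch H).

Section Arithmetic.

Local Open Scope ring_scope.

Definition symp x y := cx x * cy y - cy x * cx y.

Lemma chM x y : ch (x * y)%g = ch x + ch y - symp x y.
Proof. exact: ch_mul. Qed.

Lemma symp_sym x y : symp y x = - symp x y.
Proof. by rewrite /symp; ring. Qed.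

Lemma commute_symp x y : symp x y = 0 -> commute x y.
Proof.
move=> xy; apply: (@coord_inj _ H);
  rewrite ?cxM ?cyM ?chM ?(symp_sym x y) ?xy ?oppr0.
- exact: addrC.
- exact: addrC.
by rewrite [ch x + _]addrC.
Qed.

Lemma cx1 : cx 1%g = 0.
Proof. by apply: (addrI (cx 1%g)); rewrite -cxM mulg1 addr0. Qed.

Lemma cy1 : cy 1%g = 0.
Proof. by apply: (addrI (cy 1%g)); rewrite -cyM mulg1 addr0. Qed.

Lemma ch1 : ch 1%g = 0.
Proof.
apply: (addrI (ch 1%g)); have := chM 1%g 1%g.
by rewrite mulg1 /symp cx1 mul0r mulr0 !subr0 addr0.
Qed.

Lemma coord1 x : cx x = 0 -> cy x = 0 -> ch x = 0 -> x = 1%g.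
Proof. by move=> x0 y0 z0; apply: (@coord_inj _ H); rewrite ?cx1 ?cy1 ?ch1. Qed.

Lemma cx_prod s : cx (\prod_(x <- s) x)%g = \sum_(x <- s) cx x.
Proof. exact: (big_morph cx (cxM H) cx1). Qed.

Lemma cy_prod s : cy (\prod_(x <- s) x)%g = \sum_(x <- s) cy x.
Proof. exact: (big_morph cy (cyM H) cy1). Qed.

Lemma ch_prod s : {in s &, forall x y, symp x y = 0} ->
  ch (\prod_(x <- s) x)%g = \sum_(x <- s) ch x.
Proof.
elim: s => [|x s IH] s0; first by rewrite !big_nil ch1.
rewrite !big_cons chM IH => [|y z ys zs]; last first.
  by apply: s0; rewrite inE ?ys ?zs orbT.
suff -> : symp x (\prod_(y <- s) y)%g = 0 by rewrite subr0.
rewrite /symp cx_prod cy_prod !mulr_sumr -sumrB big1_seq // => y /= ys.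
by apply: s0; rewrite inE ?eqxx ?ys ?orbT.
Qed.

End Arithmetic.

Definition lab x : nat * nat := (val (cx x), val (cy x)).

Lemma lab_in_plane x : lab x \in plane.
Proof. by apply: allpairs_f; rewrite mem_iota; apply: ltn_ord. Qed.

Lemma zero_sum_val (I : Type) (f g : I -> 'F_3) (s : seq I) :
  zero_sum [seq (val (f i), val (g i)) | i <- s] =
  (\sum_(i <- s) f i == 0)%R && (\sum_(i <- s) g i == 0)%R.
Proof.
suff E (h : I -> 'F_3) :
    (3 %| sumn [seq val (h i) | i <- s]) = (\sum_(i <- s) h i == 0)%R.
  by rewrite /zero_sum /unzip1 /unzip2 -!map_comp /= -!E.
have -> : (\sum_(i <- s) h i = (sumn [seq val (h i) | i <- s])%:R)%R.
  by elim: s => [|i s IH]; rewrite ?big_nil ?big_cons //= natrD -IH natr_Zp.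
by rewrite -(dvdn_pcharf (pchar_Fp (isT : prime 3))).
Qed.

Lemma zero_sum_lab s : zero_sum (map lab s) =
  (\sum_(x <- s) cx x == 0)%R && (\sum_(x <- s) cy x == 0)%R.
Proof. exact: zero_sum_val. Qed.

Lemma aligned_lab x y : aligned (lab x) (lab y) = (symp x y == 0)%R.
Proof.
rewrite /aligned /symp /lab /=; move: (cx x) (cy x) (cx y) (cy y).
by do 4!elim/F3_ind.
Qed.

(** Brings tests on the remaining labels back to the remaining terms. *)
Lemma pull v s : v \in map lab s ->
  exists x s', [/\ perm_eq s (x :: s'), lab x = v
    & map lab s' = rem v (map lab s)].
Proof.
elim: s => //= y s IH; rewrite inE eq_sym.
case: eqP => [yv _|_ /= /IH [x [s' [ss xv s'E]]]].
  by exists y, s.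
exists x, (y :: s'); split=> //=; last by rewrite s'E.
by rewrite -(perm_cons y) in ss; rewrite (permPl ss) perm_swap.
Qed.

Lemma prod1_order s t : perm_eq t s -> zero_sum (map lab s) ->
  (ch (\prod_(x <- t) x)%g = 0)%R -> prod1 s.
Proof.
move=> ts; rewrite zero_sum_lab => /andP[/eqP sx /eqP sy] t0; exists t => //.
by apply: coord1; rewrite ?cx_prod ?cy_prod ?(perm_big _ ts).
Qed.

Lemma ch_swap x y z : (ch (y * (x * z))%g = ch (x * (y * z))%g - symp x y)%R.
Proof.
apply/eqP; rewrite -subr_eq0; apply/eqP.
rewrite !chM /symp !cxM !cyM.
by rewrite -[RHS](F3_3 (cx x * cy y - cy x * cx y)%R); ring.
Qed.

(** The four orderings obtained by exchanging the terms of two disjoint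
    non-commuting pairs have central values [p], [p - a], [p - b], [p - a - b]
    with [a] and [b] nonzero, so one of them is zero. *)
Lemma flexible_prod1 s : flexible (map lab s) -> prod1 s.
Proof.
case/andP=> s0 /hasP[u us /hasP[v vs /andP[uv /hasP[w ws /hasP[k]]]]].
have [wk|kw kL] := eqVneq k w; first by rewrite wk /aligned mulnC eqxx.
have [x [s1 [ss1 xu s1E]]] := pull us.
rewrite -s1E in vs ws kL.
have [y [s2 [ss2 yv s2E]]] := pull vs; rewrite -s2E in ws kL.
have [z [s3 [ss3 zw s3E]]] := pull ws.
have [|t [s4 [ss4 tk _]]] := @pull k s3; first by rewrite s3E rem_mem.
rewrite -xu -yv -zw -tk !aligned_lab in uv *.
move=> zt.
have P : perm_eq [:: x, y, z, t & s4] s.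
  rewrite perm_sym (permPl ss1) perm_cons (permPl ss2) perm_cons.
  by rewrite (permPl ss3) perm_cons.
have Pxy : perm_eq [:: y, x, z, t & s4] s by rewrite (permPl (perm_swap _ _ _)).
have Pzt : perm_eq [:: x, y, t, z & s4] s.
  by rewrite -(permPr P) !perm_cons perm_swap.
have Pxyzt : perm_eq [:: y, x, t, z & s4] s.
  by rewrite (permPl (perm_swap _ _ _)).
have E1 : ch (\prod_(i <- [:: y, x, z, t & s4]) i)%g =
    (ch (\prod_(i <- [:: x, y, z, t & s4]) i)%g - symp x y)%R.
  by rewrite !big_cons ch_swap.
have E2 : ch (\prod_(i <- [:: x, y, t, z & s4]) i)%g =
    (ch (\prod_(i <- [:: x, y, z, t & s4]) i)%g - symp z t)%R.
  rewrite !big_cons !(chM x) !(chM y) ch_swap /symp !cxM !cyM; ring.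
have E3 : ch (\prod_(i <- [:: y, x, t, z & s4]) i)%g =
    (ch (\prod_(i <- [:: x, y, z, t & s4]) i)%g - symp z t - symp x y)%R.
  by rewrite -E2 !big_cons ch_swap.
have := F3_choose (ch (\prod_(i <- [:: x, y, z, t & s4]) i)%g) uv zt.
case/or4P => /eqP e; [apply: (prod1_order P) | apply: (prod1_order Pxy)
  | apply: (prod1_order Pzt) | apply: (prod1_order Pxyzt)] => //.
- by rewrite E1.
- by rewrite E2.
- by rewrite E3.
Qed.

(** * Splitting sequences of length nine *)

(** The two cyclic orders of a triangle have central values [h - a] and [h + a],
    where [h] is the sum of the central coordinates and [a] is nonzero; in a
    field with three elements, one of them vanishes unless [h] does. *)
Lemma prod1_triangle x y z : ~~ aligned (lab x) (lab y) ->
  zero_sum [:: lab x; lab y; lab z] -> (ch x + ch y + ch z != 0)%R ->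
  prod1 [:: x; y; z].
Proof.
rewrite aligned_lab => xy s0 hz.
have := s0; rewrite (zero_sum_lab [:: x; y; z]) !big_cons !big_nil !addr0.
rewrite ![(_ + (_ + _))%R]addrC => /andP[/eqP sx /eqP sy].
have [zx zy] : (cx z = - (cx x + cx y) /\ cy z = - (cy x + cy y))%R.
  split; apply/eqP; rewrite -subr_eq0 opprK; apply/eqP.
    by rewrite -[RHS]sx; ring.
  by rewrite -[RHS]sy; ring.
have E : ch (\prod_(i <- [:: x; y; z]) i)%g = (ch x + ch y + ch z - symp x y)%R.
  by rewrite !big_cons big_nil mulg1 !chM /symp !cxM !cyM zx zy; ring.
have E' : ch (\prod_(i <- [:: y; x; z]) i)%g =
    (ch x + ch y + ch z + symp x y)%R.
  by rewrite !big_cons big_nil mulg1 !chM /symp !cxM !cyM zx zy; ring.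
case: (F3_opp hz xy) => e.
  by apply: (@prod1_order _ [:: x; y; z]) => //; rewrite E e subrr.
apply: (@prod1_order _ [:: y; x; z]) => //; last by rewrite E' e addNr.
exact: perm_swap.
Qed.

Lemma flexible_neq0 s : flexible (map lab s) -> s != [::].
Proof. by case: s. Qed.

Lemma untwisted_symp s : ~~ twisted (map lab s) ->
  {in s &, forall x y, symp x y = 0%R}.
Proof.
move/hasPn=> h x y xs ys; have /hasPn/(_ (lab y)) := h _ (map_f lab xs).
by rewrite negbK map_f // aligned_lab => /(_ isT)/eqP.
Qed.

(** Pairwise commuting elements have labels on one line through the origin, on
    which one of the two coordinates is injective. *)
Lemma line_functional s : {in s &, forall x y, symp x y = 0%R} ->
  exists f : gT -> 'F_3, forall m,
  (\sum_(x <- mask m s) f x = 0 -> \sum_(x <- mask m s) cx x = 0 /\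
    \sum_(x <- mask m s) cy x = 0)%R.
Proof.
move=> s0.
have [/hasP[x0 x0s nx0]|/hasPn h] := boolP (has (fun x => cx x != 0%R) s).
  exists cx => m m0; split=> //.
  rewrite (eq_big_seq (fun y => cx y * (cy x0 / cx x0))%R) => [|y /mem_mask ys].
    by rewrite -mulr_suml m0 mul0r.
  have /eqP := s0 _ _ x0s ys; rewrite /symp subr_eq0 => /eqP e.
  by apply: (mulfI nx0); rewrite e; field.
exists cy => m m0; split=> //; rewrite big1_seq // => y /mem_mask/h.
by rewrite negbK => /eqP.
Qed.

(** The subgroup that the elements generate with the centre embeds into the
    plane by a coordinate along the line of the labels and the central
    coordinate. *)
Lemma davenport_commuting s : size s = 5 ->
  {in s &, forall x y, symp x y = 0%R} ->
  exists m, [/\ size m = 5, has id m & (\prod_(x <- mask m s) x = 1)%g].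
Proof.
move=> s5 s0; have [f fP] := line_functional s0.
have /hasP[m] : zero_sum_sub [seq (val (f x), val (ch x)) | x <- s].
  apply: davenport_plane; first by rewrite size_map.
  by move=> _ /mapP[x _ ->]; apply: allpairs_f; rewrite mem_iota; apply: ltn_ord.
rewrite masksP size_map s5 => /eqP m5 /andP[m1].
rewrite -map_mask zero_sum_val => /andP[/eqP/fP[mx my] /eqP mh].
exists m; split=> //; apply: coord1; rewrite ?cx_prod ?cy_prod //.
by rewrite ch_prod // => x y /mem_mask xs /mem_mask ys; apply: s0.
Qed.

Lemma split_flexible_splittable s : split_flexible (map lab s) -> splittable s.
Proof.
case/hasP=> m; rewrite masksP size_map => /eqP ms.
rewrite -!map_mask => /andP[f1 f2].
exists (mask m s), (mask (neg m) s).
by split; [exact: perm_mask_neg| exact: flexible_neq0 | exact: flexible_neq0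
  | exact: flexible_prod1 | exact: flexible_prod1].
Qed.

Lemma long_line_splittable s :
  5 < size s -> prod1 s -> long_line (map lab s) -> splittable s.
Proof.
move=> s6 s1 /hasP[m]; rewrite masksP size_map => /eqP ms; cbv beta zeta.
rewrite -!map_mask; set U := mask m s; set C := mask (neg m) s.
rewrite size_map => /and3P[/eqP U5 /untwisted_symp U0 UC].
have sUC : perm_eq s (U ++ C) by apply: perm_mask_neg.
have [d [d5 d1 dU]] := davenport_commuting U5 U0.
have dsz : size d = size U by rewrite d5.
have UE := perm_mask_neg dsz.
have sE : perm_eq s (mask d U ++ (mask (neg d) U ++ C)).
  by rewrite (permPl sUC) catA perm_cat2r.
have T0 := mask_neq0 dsz d1.
have T1 : prod1 (mask d U) by exists (mask d U).
case/orP: UC => [/allP UC|/allP UC]; last first.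
  have := UC d; rewrite masksP d5 d1 -!map_mask -map_cat.
  rewrite zero_sum_lab -cx_prod -cy_prod dU cx1 cy1 eqxx.
  move=> /(_ isT)/= fl; exists (mask d U), (mask (neg d) U ++ C); split=> //.
    exact: flexible_neq0.
  exact: flexible_prod1.
exists (mask d U), (mask (neg d) U ++ C); split=> //.
  have C0 : C != [::].
    by move: s6; rewrite (perm_size sUC) size_cat U5; case: (C).
  by case: (C) C0 => // c C' _; case: (mask _ _).
apply: (prod1_remove (a := mask d U)) => //; last exact: prod1_perm s1.
move=> x y /mem_mask xU ys; apply: commute_symp.
have : y \in U ++ C by rewrite -(perm_mem sUC) (perm_mem sE).
rewrite mem_cat => /orP[yU|yC]; first exact: U0.
have /allP aC := UC _ (map_f lab xU).
by have := aC _ (map_f lab yC); rewrite aligned_lab => /eqP.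
Qed.

Lemma pull_triangle P s : has_triangle P (map lab s) ->
  exists x y z r, [/\ perm_eq s [:: x, y, z & r], ~~ aligned (lab x) (lab y),
    zero_sum [:: lab x; lab y; lab z] & P (lab x) (lab y) (lab z) (map lab r)].
Proof.
case/hasP=> u /pull[x [s1 [ss1 <- <-]]] /hasP[v /pull[y [s2 [ss2 <- <-]]]].
case/andP=> xy /hasP[w /pull[z [s3 [ss3 <- <-]]]] /andP[s0 p].
exists x, y, z, s3; split; [|exact: xy|exact: s0|exact: p].
by rewrite (permPl ss1) perm_cons (permPl ss2) perm_cons.
Qed.

Lemma triangle_zero_splittable s :
  prod1 s -> triangle_zero (map lab s) -> splittable s.
Proof.
move=> s1 /pull_triangle[x [y [z [r [sr xy s0]]]]].
case/and3P=> /pull[c [r' [rr' c0 <-]]] fr; rewrite -c0 -map_cons => fcr.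
have sE : perm_eq s [:: x, y, z, c & r'] by rewrite (permPl sr) !perm_cons.
have [cx0 cy0] : cx c = 0%R /\ cy c = 0%R.
  by case: c0 => cx0 cy0; split; apply: val_inj.
have [hT|hT] := eqVneq (ch x + ch y + ch z)%R 0%R; last first.
  exists [:: x; y; z], (c :: r').
  by split; [exact: sE| | |exact: prod1_triangle|exact: flexible_prod1].
have [hc|hc] := eqVneq (ch c) 0%R.
  apply: splittable_one s1; last by rewrite (perm_size sE).
  have cs : c \in s by rewrite (perm_mem sE) !inE eqxx !orbT.
  by rewrite (coord1 cx0 cy0 hc) in cs.
exists [:: x; y; z; c], r'.
split; [exact: sE|by []|exact: flexible_neq0 fr| |exact: flexible_prod1].
have zc : lab (z * c)%g = lab z by rewrite /lab cxM cyM cx0 cy0 !addr0.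
(* Multiplying [z] by the central [c] keeps the labels of the triangle and
   shifts the sum of its central coordinates away from zero. *)
have T1 : prod1 [:: x; y; (z * c)%g].
  apply: prod1_triangle; rewrite ?zc //.
  by rewrite chM /symp cx0 cy0 !mulr0 !subr0 addrA hT add0r.
apply: (prod1_perm (s := [:: z; c] ++ [:: x; y])); first by rewrite perm_catC.
apply: prod1_expand; apply: prod1_perm T1.
exact/permPl/(perm_catC [:: x; y] [:: (z * c)%g]).
Qed.

Lemma triangle_cube_splittable s : triangle_cube (map lab s) -> splittable s.
Proof.
case/pull_triangle=> [x1 [y [z [r [sr xy s0]]]]].
case/and4P=> /pull[x2 [r' [rr' l2 <-]]] /pull[x3 [t [rt l3 <-]]].
move=> fT fC.
pose X := [:: x1; x2; x3].
have E : perm_eq s (X ++ [:: y, z & t]).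
  have P : perm_eq s [:: x1, y, z, x2, x3 & t].
    by rewrite (permPl sr) !perm_cons (permPl rr') perm_cons.
  by rewrite (permPl P) perm_cons (perm_catCA [:: y; z] [:: x2; x3]).
have labX x : x \in X -> lab x = lab x1 by rewrite !inE => /or3P[] /eqP->.
have [/allP hX|/seq.allPn[x xX hx]] :=
    boolP (all (fun x => ch x + ch y + ch z == 0)%R X).
  exists X, [:: y, z & t].
  split; [exact: E|by []|by []| |exact: flexible_prod1].
  (* The sum over the triangle vanishes for each vertex in [X], so these have
     the same central coordinate. *)
  have X1 x : x \in X -> x = x1.
    move=> xX; have [ex ey] : lab x = lab x1 by apply: labX.
    apply: (@coord_inj _ H); [exact: val_inj|exact: val_inj|].
    apply/(addIr (ch y))/(addIr (ch z)).
    by rewrite (eqP (hX x xX)) (eqP (hX x1 (mem_head _ _))).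
  have x2E : x2 = x1 by apply: X1; rewrite !inE eqxx orbT.
  have x3E : x3 = x1 by apply: X1; rewrite !inE eqxx !orbT.
  exists X; first exact: perm_refl.
  rewrite /X x2E x3E.
  apply: coord1; rewrite ?cx_prod ?cy_prod.
  - by rewrite !big_cons big_nil addr0 -[RHS](F3_3 (cx x1)) !mulrS mulr0n addr0.
  - by rewrite !big_cons big_nil addr0 -[RHS](F3_3 (cy x1)) !mulrS mulr0n addr0.
  have x11 : {in [:: x1; x1; x1] &, forall x y, symp x y = 0%R}.
    by move=> u v; rewrite !inE !orbb => /eqP-> /eqP->; rewrite /symp mulrC subrr.
  rewrite ch_prod // !big_cons big_nil addr0.
  by rewrite -[RHS](F3_3 (ch x1)) !mulrS mulr0n addr0.
have lx := labX x xX; have XE := perm_to_rem xX.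
exists [:: x; y; z], (rem x X ++ t).
split; [|by []| |by apply: prod1_triangle; rewrite ?lx|].
- rewrite (permPl E).
  rewrite (perm_trans (y := (x :: rem x X) ++ [:: y, z & t])) ?perm_cat2r //.
  by rewrite /= perm_cons (perm_catCA (rem x X) [:: y; z]).
- by have := perm_size XE; case: (rem x X).
apply: flexible_prod1.
suff -> : map lab (rem x X ++ t) = [:: lab x1, lab x1 & map lab t] by [].
rewrite map_cat; have := perm_size XE.
have := fun y (yX : y \in rem x X) => labX y (mem_rem yX).
case: (rem x X) => [|a [|b [|]]] // lX _.
by rewrite /= !lX // !inE eqxx ?orbT.
Qed.

Lemma splittable_size9 s : size s = 9 -> prod1 s -> splittable s.
Proof.
move=> s9 s1.
have [L] : exists2 L, L \in multisets (size (map lab s)) plane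
    & perm_eq (map lab s) L.
  by apply: multisetsP => _ /mapP[x _ ->]; apply: lab_in_plane.
rewrite size_map s9 => L9 /perm_map_lift[t ts tL].
move/allP: all_reducible => /(_ L L9).
have t1 : prod1 t by apply: prod1_perm s1; rewrite perm_sym.
have tz : zero_sum (map lab t).
  case: t1 => u ut u1; rewrite zero_sum_lab -!(perm_big _ ut).
  rewrite -cx_prod -cy_prod u1.
  by rewrite cx1 cy1 eqxx.
rewrite -tL /reducible tz => red_t; apply: (splittable_perm ts).
case/or4P: red_t.
- by apply: long_line_splittable; rewrite ?(perm_size ts) ?s9.
- exact: triangle_zero_splittable.
- exact: triangle_cube_splittable.
exact: split_flexible_splittable.
Qed.

End HeisenbergCoordinates.

(** * Coordinates on the group of unitriangular matrices *)

Section Coordinates.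

Local Open Scope ring_scope.

Definition entry (i j : nat) (x : subg_of H27) : 'F_3 :=
  GLval (sgval x) (inord i) (inord j).

Lemma entry_low i j x : (j < i < 3)%N -> entry i j x = 0.
Proof.
case/andP=> ji i3; have := valP x; rewrite inE => /andP[/is_trig_mxP + _].
move/(_ (inord j) (inord i)); rewrite mxE; apply.
by rewrite !inordK // (ltn_trans ji).
Qed.

Lemma entry_diag i x : entry i i x = 1.
Proof. by have := valP x; rewrite inE => /andP[_ /forallP/(_ (inord i))/eqP]. Qed.

Lemma entryM i j x y :
  entry i j (x * y)%g = \sum_(k < 3) entry i k x * entry k j y.
Proof.
have -> : entry i j (x * y)%g =
    (GLval (sgval x) *m GLval (sgval y)) (inord i) (inord j) by rewrite -GL_MxE.
by rewrite mxE; apply: eq_bigr => k _; rewrite /entry inord_val.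
Qed.

Definition corner x := entry 0 2 x + entry 0 1 x * entry 1 2 x.

Lemma entry01M x y : entry 0 1 (x * y)%g = entry 0 1 x + entry 0 1 y.
Proof.
rewrite entryM !big_ord_recr big_ord0 /= !entry_diag (entry_low (i := 2)) //.
by ring.
Qed.

Lemma entry12M x y : entry 1 2 (x * y)%g = entry 1 2 x + entry 1 2 y.
Proof.
rewrite entryM !big_ord_recr big_ord0 /= !entry_diag (entry_low (i := 1)) //.
by ring.
Qed.

Lemma cornerM x y : corner (x * y)%g = corner x + corner y -
  (entry 0 1 x * entry 1 2 y - entry 1 2 x * entry 0 1 y).
Proof.
rewrite /corner entry01M entry12M entryM !big_ord_recr big_ord0 /= !entry_diag.
apply/eqP; rewrite -subr_eq0; apply/eqP.
(* The two sides differ by three times this product. *)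
by rewrite -[RHS](F3_3 (entry 0 1 x * entry 1 2 y)); ring.
Qed.

Lemma entry_inj x y : entry 0 1 x = entry 0 1 y ->
  entry 1 2 x = entry 1 2 y -> corner x = corner y -> x = y.
Proof.
rewrite /corner => exy eyy; rewrite exy eyy => /addIr ezz.
apply/val_inj/val_inj/matrixP => i j; rewrite -[i]inord_val -[j]inord_val.
change (entry i j x = entry i j y).
have [ij|ji|<-] := ltngtP i j; last by rewrite !entry_diag.
  by case: i j ij => [[|[|[|]]] //= hi] [[|[|[|]]] //= hj].
by rewrite !entry_low // ji ltn_ord.
Qed.

Definition H27_coords : heis_coords (subg_of H27) :=
  HeisCoords entry01M entry12M cornerM entry_inj.

End Coordinates.

Theorem proposition5p3 : large_davenport H27 <= 8.
Proof. by apply: large_davenport_le; apply: splittable_size9 H27_coords. Qed.
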